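(* Let $\mathcal P$ be an additive induced-hereditary hypergraph property, let $G$ be a $\mathcal P$-strict hypergraph with $dec_{\mathcal P}(G)=n$, and let $d_0=(U_1,\dots,U_m)$ be a fixed $\mathcal P$-decomposition of $G$. Then there exist a positive integer $s$ and a $\mathcal P$-strict hypergraph $G^*\in s\circledast G$ such that $G^*$ respects $d_0$, and moreover every $\mathcal P$-decomposition of $G^*$ with $n$ parts respects $d_0$ uniformly.
   Context: All hypergraphs are finite, without loops or multiple edges; each edge is an ordered tuple $(v_1,\dots,v_r;c)$ of $r\ge 2$ distinct vertices together with a colour $c$, and isomorphisms must preserve the order and colour of edges. For $U\subseteq V(H)$, $H[U]$ is the hypergraph on $U$ whose edges are those edges of $H$ all of whose vertices lie in $U$; $G\le H$ means $G$ is isomorphic to $H[U]$ for some $U$. A property is a nonempty isomorphism-closed class of hypergraphs (the null hypergraph is regarded as belonging to every property); it is induced-hereditary if closed under $\le$, and additive if closed under disjoint unions. For hypergraphs $G_1,\dots,G_n$ on pairwise disjoint vertex sets, $G_1*\cdots*G_n$ is the set of all hypergraphs $H$ with $V(H)=\bigcup_i V(G_i)$ and $H[V(G_i)]=G_i$ for all $i$; for sets $S_i$ of hypergraphs, $S_1*\cdots*S_n$ is the union of $G_1*\cdots*G_n$ over all choices $G_i\in S_i$. $kG$ is the disjoint union of $k$ copies of $G$; $K_1$ is the one-vertex hypergraph. A $\mathcal P$-decomposition of $G$ with $n$ parts is a partition $(V_1,\dots,V_n)$ of $V(G)$ into nonempty sets such that $kG[V_1]*\cdots*kG[V_n]\subseteq\mathcal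 P$ for every positive integer $k$. $dec_{\mathcal P}(G)$ is the maximum number of parts in a $\mathcal P$-decomposition of $G$ ($0$ if $G\notin\mathcal P$). $G$ is $\mathcal P$-strict if $G\in\mathcal P$ but $G*K_1\not\subseteq\mathcal P$. $s\circledast G$ denotes $G*G*\cdots*G$ ($s$ disjoint copies $G^1,\dots,G^s$ of $G$). For $G^*\in s\circledast G$, write $U_j^k$ for the copy of $U_j$ in $G^k$. $G^*$ respects $d_0=(U_1,\dots,U_m)$ if $G^*\in sG[U_1]*\cdots*sG[U_m]$, i.e. every edge of $G^*$ meeting two different copies $G^i$ also meets two different sets $\bigcup_k U_x^k$, $\bigcup_k U_y^k$ with $x\ne y$. A $\mathcal P$-decomposition $(V_1,\dots,V_n)$ of $G^*$ respects $d_0$ uniformly if for each $V_i$ there is a $j$ such that $V_i\cap V(G^k)\subseteq U_j^k$ for every $k=1,\dots,s$. *)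

(* Defs.v *)
From mathcomp Require Import boolp classical_sets cardinality.
From mathcomp Require Import all_boot.

Set Implicit Arguments.
Unset Strict Implicit.
Unset Printing Implicit Defensive.

(* The edge (v_1, ..., v_r; c) is the pair ([:: v_1; ...; v_r], c). The edges
   form a set, which is what excludes multiple edges. As C may be infinite,
   finiteness of the edge set does not follow from that of V. *)
Record hypergraph (C : Type) (V : finType) := Hypergraph {
  hedges : set (seq V * C);
  hedges_tuple : forall e, hedges e -> (2 <= size e.1)%N && uniq e.1;
  hedges_finite : finite_set hedges
}.

Lemma hypergraphP (C : Type) (V : finType) (G H : hypergraph C V) :
  (forall e c, hedges G (e, c) <-> hedges H (e, c)) <-> G = H.
Proof.
split=> [eGH|-> //]; case: G H eGH => [E1 t1 f1] [E2 t2 f2] /= eE.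
have {}eE : E1 = E2 by apply/seteqP; split=> [[e c]|[e c]] /eE.
by case: _ / eE in t2 f2 *; congr Hypergraph; apply: Prop_irrelevance.
Qed.

Lemma finite_uniq_seq (V : finType) : finite_set (fun e : seq V => is_true (uniq e)).
Proof.
have fin : finite_set (\bigcup_(n in `I_#|V|.+1)
    range (fun t : n.-tuple V => val t))%classic.
  by apply: bigcup_finite => // n _; apply/finite_image/finite_finset.
apply: sub_finite_set fin => e ue; exists (size e) => /=.
  by rewrite ltnS -(card_uniqP ue) max_card.
by exists (in_tuple e).
Qed.

Lemma finite_edges (C : Type) (V : finType) (E : set (seq V * C)) (D : set C) :
  finite_set D -> (forall e, E e -> uniq e.1 /\ D e.2) -> finite_set E.
Proof.
move=> finD ED; apply: sub_finite_set (finite_setX (finite_uniq_seq V) finD).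
by move=> e /ED.
Qed.

(* For injective f this is H[f(V)] with its vertices renamed along f. *)
Section Pullback.
Variables (C : Type) (V W : finType) (f : V -> W) (H : hypergraph C W).

Definition hpull_edges : set (seq V * C) :=
  fun e => hedges H (map f e.1, e.2).

Lemma hpull_tuple e : hpull_edges e -> (2 <= size e.1)%N && uniq e.1.
Proof.
by move=> /hedges_tuple /=; rewrite size_map => /andP[-> /map_uniq ->].
Qed.

Lemma hpull_finite : finite_set hpull_edges.
Proof.
apply: (@finite_edges _ _ _ (snd @` hedges H)%classic).
  exact/finite_image/hedges_finite.
move=> e eE; split; first by have /andP[] := hpull_tuple eE.
by exists (map f e.1, e.2).
Qed.

Definition hpull : hypergraph C V := Hypergraph hpull_tuple hpull_finite.
End Pullback.

Definition hinduced (C : Type) (V : finType) (G : hypergraph C V)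
  (U : {set V}) : hypergraph C {x : V | x \in U} := hpull val G.

Definition hiso (C : Type) (V W : finType)
    (G : hypergraph C V) (H : hypergraph C W) : Prop :=
  exists2 f : V -> W, bijective f & G = hpull f H.

Definition hle (C : Type) (V W : finType)
    (G : hypergraph C V) (H : hypergraph C W) : Prop :=
  exists U : {set W}, hiso G (hinduced H U).

Section Edgeless.
Variables (C : Type) (V : finType).

Lemma hempty_tuple e :
  (@classical_sets.set0 (seq V * C)) e -> (2 <= size e.1)%N && uniq e.1.
Proof. by []. Qed.

Definition hempty : hypergraph C V :=
  Hypergraph hempty_tuple (@finite_set0 (seq V * C)).
End Edgeless.

Definition hnull (C : Type) : hypergraph C void := hempty C void.
Definition hK1 (C : Type) : hypergraph C unit := hempty C unit.

(* V(G_1), ..., V(G_n) are made disjoint by tagging; the vertices coming from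
   G_i are the pairs Tagged V (x : V i). *)
Section Families.
Variables (C : Type) (I : finType) (V : I -> finType).
Variable G : forall i, hypergraph C (V i).

Definition hdisj_edges : set (seq {i : I & V i} * C) :=
  fun e => exists i (e' : seq (V i)),
    hedges (G i) (e', e.2) /\ e.1 = map (Tagged V) e'.

Lemma hdisj_tuple e : hdisj_edges e -> (2 <= size e.1)%N && uniq e.1.
Proof.
case: e => _ c [i [e' [/= /hedges_tuple /= /andP[e2 ue] ->]]].
by rewrite size_map e2 map_inj_uniq //; apply: eq_from_Tagged.
Qed.

Lemma hdisj_finite : finite_set hdisj_edges.
Proof.
apply: (@finite_edges _ _ _ (\bigcup_(i in [set: I]) (snd @` hedges (G i)))%classic).
  apply: bigcup_finite => [|i _]; first exact: finite_finset.
  exact/finite_image/hedges_finite.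
move=> e eE; split; first by have /andP[] := hdisj_tuple eE.
by case: eE => i [e' [Ge' _]]; exists i => //; exists (e', e.2).
Qed.

Definition hdisj : hypergraph C {i : I & V i} :=
  Hypergraph hdisj_tuple hdisj_finite.

Definition hstar (H : hypergraph C {i : I & V i}) : Prop :=
  forall i, hpull (Tagged V) H = G i.
End Families.

Definition hstar2 (C : Type) (V W : finType) (G1 : hypergraph C V)
    (G2 : hypergraph C W) (H : hypergraph C (V + W)%type) : Prop :=
  hpull inl H = G1 /\ hpull inr H = G2.

Definition hcopies (C : Type) (V : finType) (k : nat) (G : hypergraph C V) :
  hypergraph C {_ : 'I_k & V} := hdisj (fun _ : 'I_k => G).

Definition hproperty (C : Type) := forall V : finType, hypergraph C V -> Prop.

(* Containing the null hypergraph makes the class nonempty. *)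
Definition is_property (C : Type) (P : hproperty C) : Prop :=
  P void (hnull C) /\
  forall (V W : finType) (G : hypergraph C V) (H : hypergraph C W),
    hiso G H -> P V G -> P W H.

Definition induced_hereditary (C : Type) (P : hproperty C) : Prop :=
  forall (V W : finType) (G : hypergraph C V) (H : hypergraph C W),
    hle G H -> P W H -> P V G.

Definition additive (C : Type) (P : hproperty C) : Prop :=
  forall (I : finType) (V : I -> finType) (G : forall i, hypergraph C (V i)),
    (forall i, P (V i) (G i)) -> P _ (hdisj G).

Definition ordered_partition (V : finType) (n : nat) (d : 'I_n -> {set V}) :
    Prop :=
  [/\ forall i, d i != set0,
      forall i j, i != j -> [disjoint d i & d j]
    & \bigcup_i d i = [set: V]].

Definition decomposition (C : Type) (P : hproperty C) (V : finType)
    (G : hypergraph C V) (n : nat) (d : 'I_n -> {set V}) : Prop :=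
  ordered_partition d /\
  forall k : nat, (0 < k)%N ->
    forall H, hstar (fun i : 'I_n => hcopies k (hinduced G (d i))) H -> P _ H.

Lemma ordered_partition_size (V : finType) (n : nat) (d : 'I_n -> {set V}) :
  ordered_partition d -> (n <= #|V|)%N.
Proof.
case=> d0 dd _; have /fin_all_exists [x xd] i : exists x, x \in d i.
  exact/set0Pn.
suff xinj : injective x by rewrite -[n]card_ord; apply: leq_card xinj.
move=> i j xij; apply/eqP/negPn/negP => /dd /pred0P /(_ (x i)) /=.
by rewrite xd xij xd.
Qed.

(* By ordered_partition_size the bound n <= #|V| loses nothing. *)
Definition dec (C : Type) (P : hproperty C) (V : finType)
    (G : hypergraph C V) : nat :=
  if `[< P V G >] then
    \max_(n < #|V|.+1 |
           `[< exists d : 'I_n -> {set V}, decomposition P G d >]) n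
  else 0%N.

Definition strict (C : Type) (P : hproperty C) (V : finType)
    (G : hypergraph C V) : Prop :=
  P V G /\ ~ (forall H, hstar2 G (hK1 C) H -> P _ H).

Definition hpow (C : Type) (V : finType) (s : nat) (G : hypergraph C V)
    (Gs : hypergraph C {_ : 'I_s & V}) : Prop :=
  hstar (fun _ : 'I_s => G) Gs.

(* Identifies the vertex set of sG[U_1] * ... * sG[U_m] with that of G * ... * G:
   the vertex x of the k-th copy of G[U_j] is the vertex x of G^k. *)
Definition regroup (V : finType) (s m : nat) (U : 'I_m -> {set V})
    (x : {j : 'I_m & {_ : 'I_s & {v : V | v \in U j}}}) : {_ : 'I_s & V} :=
  Tagged (fun _ => V) (i := tag (tagged x)) (val (tagged (tagged x))).

Definition respects (C : Type) (V : finType) (s m : nat) (G : hypergraph C V)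
    (U : 'I_m -> {set V}) (Gs : hypergraph C {_ : 'I_s & V}) : Prop :=
  hstar (fun j : 'I_m => hcopies s (hinduced G (U j))) (hpull (@regroup V s m U) Gs).

Lemma seq_tagged (I : eqType) (T : I -> Type) (i : I) (e : seq {i : I & T i}) :
  all (fun x => tag x == i) e -> exists e', e = map (Tagged T) (e' : seq (T i)).
Proof.
elim: e => [|[k x] e IH] /=; first by exists [::].
case/andP=> /eqP ki; rewrite {}ki in x * => /IH [e' ->].
by exists (x :: e').
Qed.

(* The two descriptions of "G^* respects d_0" agree. *)
Lemma respectsP (C : Type) (V : finType) (s m : nat) (G : hypergraph C V)
    (U : 'I_m -> {set V}) (Gs : hypergraph C {_ : 'I_s & V}) :
  ordered_partition U -> hpow G Gs ->
  respects G U Gs <->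
  (forall e c, hedges Gs (e, c) ->
     (exists x y, [/\ x \in e, y \in e & tag x != tag y]) ->
     exists x y i j, [/\ x \in e, y \in e, i != j,
                         tagged x \in U i & tagged y \in U j]).
Proof.
case=> _ dU cU GsG; split=> [resp e c ec [x [y [xe ye xy]]]|resp j].
  have [j xj] : exists j, tagged x \in U j.
    have /bigcupP[j _ xj] : tagged x \in \bigcup_i U i by rewrite cU inE.
    by exists j.
  case: (boolP (all (fun z => tagged z \in U j) e)) => [/allP eU|]; last first.
    case/allPn=> z ze zj; exists x, z, j.
    have /bigcupP[i _ zi] : tagged z \in \bigcup_i U i by rewrite cU inE.
    by exists i; split=> //; apply: contraNneq zj => ->.
  have [e' ee'] : exists e' : seq {_ : 'I_s & {v : V | v \in U j}},
      e = [seq regroup (Tagged (fun j => {_ : 'I_s & {v : V | v \in U j}}) z)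
              | z <- e'].
    elim: e eU {ec xe ye} => [|[k z] e IH] eU; first by exists [::].
    have [|e' ->] := IH; first by move=> w we; apply: eU; rewrite inE we orbT.
    have zj : z \in U j by apply: (eU (existT _ k z)); rewrite inE eqxx.
    by exists (Tagged _ (i := k) (exist _ z zj) :: e').
  have /hypergraphP /(_ e' c) [+ _] := resp j.
  case=> [|k [e'' [_ /= e'E]]]; first by rewrite /= /hpull_edges /= -!map_comp -ee'.
  have tk z : z \in e -> tag z = k.
    by rewrite ee' e'E -map_comp => /mapP[w _ ->].
  by rewrite !tk ?eqxx // in xy.
apply/hypergraphP => e c; rewrite /= /hpull_edges /= /hpull_edges /= -map_comp.
split=> [ec|[k [e' [Ge' /= ->]]]]; last first.
  have /hypergraphP /(_ (map val e') c) [_] := GsG k.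
  by move/(_ Ge'); rewrite /= /hpull_edges /= -!map_comp.
case: e ec => [|x0 e] ec; first by have := hedges_tuple ec.
case: (boolP (all (fun z => tag z == tag x0) (x0 :: e))) => [|/allPn[z ze zx]].
  case/seq_tagged=> e' ee'; exists (tag x0), e'; split=> //=.
  have /hypergraphP /(_ (map val e') c) [+ _] := GsG (tag x0); apply.
  by move: ec; rewrite ee' /= /hpull_edges /= -!map_comp.
have [|x [y [i [i' [xe ye ii' xi yi']]]]] := resp _ _ ec.
  pose T j := {_ : 'I_s & {v : V | v \in U j}}.
  exists (regroup (Tagged T z)), (regroup (Tagged T x0)); split => //.
    exact: (map_f (fun x => regroup (Tagged T x))).
  exact/(map_f (fun x => regroup (Tagged T x)))/mem_head.
set es := (X in x \in X) in xe.
have inU w : w \in es -> tagged w \in U j by case/mapP=> v _ ->; apply: valP.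
have ij (w : {_ : 'I_s & V}) (k : 'I_m) : tagged w \in U j -> tagged w \in U k -> k = j.
  move=> wj wk; apply/eqP/negPn/negP => /dU /pred0P /(_ (tagged w)) /=.
  by rewrite wj wk.
by move: ii'; rewrite (ij x i (inU x xe) xi) (ij y i' (inU y ye) yi') eqxx.
Qed.

Definition respects_uniformly (V : finType) (s m n : nat)
    (U : 'I_m -> {set V}) (d : 'I_n -> {set {_ : 'I_s & V}}) : Prop :=
  forall i, exists j, forall (k : 'I_s) (v : V),
    Tagged (fun _ => V) (i := k) v \in d i -> v \in U j.

(* Main.v *)
(* A decomposition with n = dec(G) parts of a power of G induces an n-coloring
   of every copy of G, because a strict hypergraph meets every part. If such a
   coloring does not refine d_0, the common refinement has more than n classes,
   so it is not a decomposition; a hypergraph witnessing this, of which only the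
   edges crossing the parts of d_0 are kept, can be planted on copies of G and
   forbids that all of them receive this coloring. Doing this for all the bad
   colorings in turn gives a power in which every n-part decomposition refines
   d_0 on some copy of G. Any other vertex w must then agree with this copy: if
   w lay in a color class V_i and in U_y, while V_i meets the copy inside another
   U_x, then each edge joining w to the copy would cross either two parts of d_0
   or two color classes, and G * K_1 would be contained in P. *)
Require Import Defs.
From mathcomp Require Import boolp classical_sets cardinality.
From mathcomp Require Import all_boot.

Set Implicit Arguments.
Unset Strict Implicit.
Unset Printing Implicit Defensive.

(** * Sequences on which a coloring is constant *)

Definition monochromatic (T : eqType) (I : Type) (g : T -> I) (e : seq T) :=
  {in e &, forall x y, g x = g y}.

Lemma monochromatic_map (T T' : eqType) (I : Type) (g : T' -> I) (h : T -> T')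
    (e : seq T) :
  monochromatic g (map h e) = monochromatic (g \o h) e.
Proof.
apply: propext; split=> [mono x y xe ye|mono _ _ /mapP[x xe ->] /mapP[y ye ->]].
  by apply: mono; apply: map_f.
exact: mono.
Qed.

Lemma monochromatic_cst (T : eqType) (I : Type) (g : T -> I) (i : I)
    (e : seq T) :
  {in e, forall x, g x = i} -> monochromatic g e.
Proof. by move=> ge x y /ge -> /ge ->. Qed.

Lemma seq_pair (A B : eqType) (a : A) (e : seq (A * B)) :
  {in e, forall x, x.1 = a} -> e = map (pair a) (map snd e).
Proof.
move=> ea; rewrite -map_comp -[LHS]map_id; apply/eq_in_map => -[x y] xe.
by rewrite /= -(ea _ xe).
Qed.

Lemma seq_inl (T : eqType) (e : seq (T + unit)%type) :
  inr tt \notin e -> exists e' : seq T, e = map inl e'.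
Proof.
elim: e => [|[v|[]] e IH] //=; first by exists [::].
by rewrite inE /= => /IH[e' ->]; exists (v :: e').
Qed.

(** * Edges and pullbacks of hypergraphs *)

Section Pull.
Variables (C : Type).
Implicit Types (V W : finType).

Lemma edge_mem V (H : hypergraph C V) e c :
  hedges H (e, c) -> exists x, x \in e.
Proof. by case: e => [/hedges_tuple //|x e _]; exists x; apply: mem_head. Qed.

Lemma edge_other V (H : hypergraph C V) e c x :
  hedges H (e, c) -> exists2 y, y \in e & y != x.
Proof.
move=> /hedges_tuple /=; case: e => [//|y [//|z e]] /= /andP[yz _].
have [yx|yx] := eqVneq y x; last by exists y; rewrite ?mem_head.
exists z; first by rewrite !inE eqxx orbT.
by apply: contraNneq yz => zx; rewrite inE zx yx eqxx.
Qed.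

Lemma edge_inl V (J : hypergraph C (V + unit)%type) e c :
  hedges J (e, c) -> exists v, inl v \in e.
Proof.
move=> /(edge_other (inr tt))[[v ve _|[] _]]; first by exists v.
by rewrite eqxx.
Qed.

Lemma hypergraph_of_edges V (E : set (seq V * C)) (D : set C) :
  finite_set D ->
  (forall e, E e -> (2 <= size e.1)%N && uniq e.1 /\ D e.2) ->
  exists H : hypergraph C V, hedges H = E.
Proof.
move=> finD ED.
have tE e : E e -> (2 <= size e.1)%N && uniq e.1 by case/ED.
have fE : finite_set E.
  by apply: finite_edges finD _ => e /ED[/andP[_ ?] ?].
by exists (Hypergraph tE fE).
Qed.

Definition colors V (H : hypergraph C V) : set C := (snd @` hedges H)%classic.

Lemma finite_colors V (H : hypergraph C V) : finite_set (colors H).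
Proof. exact/finite_image/hedges_finite. Qed.

Lemma finite_colorsU V W (G : hypergraph C V) (H : hypergraph C W) :
  finite_set (colors G `|` colors H)%classic.
Proof. by rewrite finite_setU; split; apply: finite_colors. Qed.

Lemma edge_colors V (H : hypergraph C V) e c : hedges H (e, c) -> colors H c.
Proof. by exists (e, c). Qed.

Lemma edge_map_tuple V W (H : hypergraph C V) (g : V -> W) e c :
  injective g -> hedges H (e, c) ->
  (2 <= size (map g e))%N && uniq (map g e).
Proof. by move=> ginj /hedges_tuple; rewrite size_map map_inj_uniq. Qed.

Lemma hpullE V W (f : V -> W) (H : hypergraph C W) G :
  hpull f H = G -> forall e c, hedges H (map f e, c) <-> hedges G (e, c).
Proof. by move=> <-. Qed.

Lemma hpullK V W (f : V -> W) (g : W -> V) (H : hypergraph C W) :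
  cancel g f -> hpull g (hpull f H) = H.
Proof.
move=> gK; apply/hypergraphP => e c.
by rewrite /= /hpull_edges /= /hpull_edges /= mapK.
Qed.

Variable P : hproperty C.
Hypothesis hered : induced_hereditary P.

Lemma property_pull V W (f : V -> W) (H : hypergraph C W) :
  injective f -> P H -> P (hpull f H).
Proof.
move=> finj; apply: hered.
have fU x : f x \in [set f y | y in [set: V]] by apply: imset_f; rewrite inE.
exists [set f x | x in [set: V]], (fun x => exist _ (f x) (fU x)).
  apply: inj_card_bij => [x y [/finj]//|].
  by rewrite card_sig -[X in (_ <= X)%N]cardsT -(card_imset _ finj).
apply/hypergraphP => e c.
by rewrite /= /hpull_edges /= /hpull_edges /= -map_comp.
Qed.
End Pull.

(* A coloring of V(G) is unconstrained when [P] contains every hypergraph on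
   copies of vertices of G (the vertex w being the copy number [kappa w] of
   [phi w]) that agrees with the disjoint union of the copies of G on the
   monochromatic tuples. Its nonempty color classes then form a decomposition. *)
Definition unconstrained (C : Type) (P : hproperty C) (V : finType)
    (G : hypergraph C V) (I : Type) (f : V -> I) : Prop :=
  forall (K W : finType) (kappa : W -> K) (phi : W -> V) (H : hypergraph C W),
    injective (fun w => (kappa w, phi w)) ->
    (forall e c, monochromatic (f \o phi) e ->
       hedges H (e, c) <->
       monochromatic kappa e /\ hedges G (map phi e, c)) ->
    P W H.

(** * Unconstrained colorings, decompositions and strictness *)

Section Unconstrained.
Variables (C : Type) (P : hproperty C).
Hypothesis hered : induced_hereditary P.
Implicit Types (V W : finType).

Lemma unconstrained_pull V W (H : hypergraph C W) (g : V -> W) (I : Type)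
    (f : W -> I) :
  injective g -> unconstrained P H f -> unconstrained P (hpull g H) (f \o g).
Proof.
move=> ginj fH K X kappa phi J inj JE.
apply: (fH K X kappa (g \o phi)) => [x y [kxy /ginj pxy]|e c mono].
  by apply: inj; rewrite /= kxy pxy.
by rewrite JE //= /hpull_edges /= -map_comp.
Qed.

Lemma unconstrained_property V (H : hypergraph C V) (I : Type) (f : V -> I) :
  unconstrained P H f -> P H.
Proof.
move=> fH; apply: (fH unit V (fun=> tt) id) => [x y [] //|e c _].
by rewrite map_id; split=> [?|[]//]; split.
Qed.

(** The classes of [f] are the parts of [d]. Only finitely many copies of [G] occur in a given [H],
    so [H] is induced in a member of the product of the [kG[d i]] for large [k]. *)
Lemma decomposition_unconstrained V (G : hypergraph C V) n
    (d : 'I_n -> {set V}) :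
  decomposition P G d ->
  exists f : V -> 'I_n,
    [/\ forall v i, (v \in d i) <-> f v = i, forall i, exists v, f v = i
      & unconstrained P G f].
Proof.
case=> -[dn0 dd dT] dP.
have /fin_all_exists[f fd] v : exists i, v \in d i.
  have /bigcupP[i _ vi] : v \in \bigcup_i d i by rewrite dT inE.
  by exists i.
have fE v i : (v \in d i) <-> f v = i.
  split=> [vi|<-//]; apply/eqP/negPn/negP => /dd /pred0P /(_ v) /=.
  by rewrite fd vi.
exists f; split=> // [i|K W kappa phi H inj HE].
  by have /set0Pn[v /fE] := dn0 i; exists v.
(* The successor keeps [k] positive when [K] is empty. *)
pose k := #|K|.+1.
pose iota x : 'I_k := widen_ord (leqnSn _) (enum_rank x).
have iotaI : injective iota.
  by move=> x y /(congr1 val) /= /ord_inj /enum_rank_inj.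
pose psi w := (iota (kappa w), phi w).
have psiI : injective psi.
  by move=> x y [/ord_inj/enum_rank_inj kxy pxy]; apply: inj; rewrite /= kxy pxy.
(* [Hk] completes [H] to [k] full copies of [V], adding only the edges that each copy of [G] has
   inside a color class. *)
have [Hk HkE] : exists Hk : hypergraph C ('I_k * V)%type, hedges Hk =
    fun e => (exists2 e0, e.1 = map psi e0 & hedges H (e0, e.2)) \/
      [/\ monochromatic (f \o snd) e.1, monochromatic fst e.1
        & hedges G (map snd e.1, e.2)].
  apply: hypergraph_of_edges (finite_colorsU H G) _ => -[e c] /=.
  case=> [[e0 -> He0]|[_ mono Ge]].
    by split; [apply: edge_map_tuple He0|left; apply: edge_colors He0].
  split; last by right; apply: edge_colors Ge.
  have := hedges_tuple Ge; rewrite /= size_map => /andP[-> ].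
  exact: map_uniq.
have <- : hpull psi Hk = H.
  apply/hypergraphP => e c; rewrite /= /hpull_edges /= HkE /=.
  split=> [[[e0 /(inj_map psiI) ->] //|]|He]; last by left; exists e.
  rewrite !monochromatic_map -map_comp => -[mono kmono Ge].
  by apply/HE => //; split=> // x y xe ye; apply/iotaI/kmono.
apply: property_pull => //.
pose T i := {_ : 'I_k & {x : V | x \in d i}}.
pose rho (x : {i : 'I_n & T i}) :=
  (tag (tagged x), val (tagged (tagged x))).
pose rho' (x : 'I_k * V) : {i : 'I_n & T i} :=
  Tagged T (i := f x.2)
    (Tagged (fun=> _) (i := x.1) (exist (fun y => y \in d (f x.2)) x.2 (fd x.2))).
have rhoK : cancel rho' rho by case.
rewrite -(hpullK Hk rhoK); apply: property_pull => //; first exact: can_inj rhoK.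
apply: (dP k) => // i; apply/hypergraphP => e c.
rewrite /= /hpull_edges /= /hpull_edges /= -map_comp HkE /=.
have tagi : {in map (rho \o Tagged T (i:=i)) e, forall x, f x.2 = i}.
  by move=> _ /mapP[x _ ->]; apply/fE/valP.
split=> [He|[l [e' [/= Ge ->]]]].
  have {He} : monochromatic fst (map (rho \o Tagged T (i:=i)) e) /\
      hedges G (map snd (map (rho \o Tagged T (i:=i)) e), c).
    case: He => [[e0 ee0 He0]|[//]]; rewrite ee0 in tagi *.
    have mono0 : monochromatic (f \o phi) e0.
      apply: (@monochromatic_cst _ _ _ i) => w we.
      by apply: (tagi (psi w)); apply: map_f.
    move/HE: He0 => /(_ mono0)[kmono Ge0]; split; last by rewrite -map_comp.
    by rewrite monochromatic_map => x y xe ye; rewrite /= (kmono x y).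
  case=> mono; rewrite -map_comp => Ge.
  have [x0 /mapP[y0 y0e _]] := edge_mem Ge.
  have /seq_tagged[e' ee'] : all (fun x => tag x == tag y0) e.
    by apply/allP => y ye; apply/eqP; apply: mono (map_f _ ye) (map_f _ y0e).
  exists (tag y0), e'; split=> //=; move: Ge.
  by rewrite {1}ee' -!map_comp.
right; split.
- apply: (@monochromatic_cst _ _ _ i) => _ /mapP[x _ ->].
  exact/fE/valP.
- apply: (@monochromatic_cst _ _ _ l) => _ /mapP[x xe ->] /=.
  by case/mapP: xe => y _ ->.
- by move: Ge; rewrite -!map_comp.
Qed.

Lemma unconstrained_dec V (G : hypergraph C V) (I : finType) (f : V -> I) :
  unconstrained P G f -> (#|[set f v | v in [set: V]]| <= dec P G)%N.
Proof.
move=> fG; set A := [set f v | v in [set: V]].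
(* Colors are renumbered through the image of [f], so that no part is empty. *)
pose d (i : 'I_#|A|) := [set v | f v == enum_val i].
have dd : decomposition P G d.
  split; first split.
  - move=> i; have /imsetP[v _ iv] := enum_valP i.
    by apply/set0Pn; exists v; rewrite inE iv.
  - move=> i j ij; apply/pred0P => v /=; rewrite !inE.
    by apply: contraNF ij => /andP[/eqP -> /eqP /enum_val_inj ->].
  - apply/setP => v; rewrite !inE; apply/bigcupP.
    have fA : f v \in A by apply: imset_f; rewrite inE.
    by exists (enum_rank_in fA (f v)) => //; rewrite inE enum_rankK_in.
  move=> k _ H HE.
  pose T i := {_ : 'I_k & {x : V | x \in d i}}.
  apply: (fG 'I_k _ (fun x => tag (tagged x))
    (fun x => val (tagged (tagged x)))) => [|e c mono].
    move=> [i [l [v vi]]] [j [l' [v' v'j]]] /= [ll' vv'].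
    subst l' v'; have ij : i = j.
      by move: vi v'j; rewrite !inE => /eqP -> /eqP /enum_val_inj.
    by subst j; rewrite (bool_irrelevance vi v'j).
  case: e mono => [mono|x0 e mono].
    by split=> [/hedges_tuple //|[_ /hedges_tuple]].
  have tagf (x : {i & T i}) : f (val (tagged (tagged x))) = enum_val (tag x).
    by have := valP (tagged (tagged x)); rewrite inE => /eqP.
  have /seq_tagged[e' ->] : all (fun x => tag x == tag x0) (x0 :: e).
    apply/allP => x xe; apply/eqP/enum_val_inj; rewrite -!tagf.
    by apply: mono => //; apply: mem_head.
  rewrite (hpullE (HE (tag x0))) /= /hpull_edges /=.
  rewrite monochromatic_map -map_comp.
  split=> [[l [e'' [/= Ge'' ->]]]|[kmono Ge]].
    split; first by rewrite monochromatic_map.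
    by move: Ge''; rewrite -!map_comp.
  have [_ /mapP[y0 y0e _]] := edge_mem Ge.
  have /seq_tagged[e'' ee''] : all (fun x => tag x == tag y0) e'.
    by apply/allP => y ye; apply/eqP; apply: kmono.
  exists (tag y0), e''; split=> //=; move: Ge.
  by rewrite ee'' -!map_comp.
rewrite /dec asboolT; last exact: unconstrained_property fG.
have AV : (#|A| < #|V|.+1)%N by rewrite ltnS; apply: ordered_partition_size dd.1.
apply: (@leq_bigmax_cond _ _ _ (Ordinal AV)).
by apply/asboolP; exists d.
Qed.

Variables (V : finType) (G : hypergraph C V).
Hypothesis Gstrict : strict P G.

(** Every one-vertex extension [J] of [G] is induced in one of [H]: the edges of [J] at the new
    vertex are glued onto the copy of [G] in [H]. *)
Lemma strict_super W (H : hypergraph C W) (g : V -> W) :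
  injective g -> hpull g H = G -> P H -> strict P H.
Proof.
move=> ginj gH PH; split=> // HK1; apply: Gstrict.2 => J [J1 J2].
pose g1 (x : V + unit) : W + unit :=
  match x with inl v => inl (g v) | inr t => inr t end.
have inlI : injective (@inl W unit) by move=> x y [].
have g1I : injective g1 by case=> [v|[]] [w|[]] //= [/ginj ->].
have [J' J'E] : exists J' : hypergraph C (W + unit)%type, hedges J' =
    fun e => (exists2 e0, e.1 = map inl e0 & hedges H (e0, e.2)) \/
      (exists2 e0, e.1 = map g1 e0 & hedges J (e0, e.2) /\ inr tt \in e0).
  apply: hypergraph_of_edges (finite_colorsU H J) _ => -[e c] /=.
  case=> -[e0 -> He0].
    split; last by left; apply: edge_colors He0.
    exact: edge_map_tuple He0.
  split; last by right; apply: edge_colors He0.1.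
  exact: edge_map_tuple He0.1.
have <- : hpull g1 J' = J.
  apply/hypergraphP => e c; rewrite /= /hpull_edges /= J'E /=.
  case: (boolP (inr tt \in e)) => ie.
    split=> [[[e0 ee0 _]|[e0 /(inj_map g1I) -> []]]|Je] //; last first.
      by right; exists e.
    have : inr tt \in map g1 e by apply: (map_f g1 ie).
    by rewrite ee0 => /mapP[].
  have [e' ee'] := seq_inl ie; rewrite ee' (hpullE J1) -gH /= /hpull_edges /=.
  split=> [[[e0]|[e0]]|He].
  - by rewrite -map_comp (map_comp inl g) => /(inj_map inlI) ->.
  - by move=> /(inj_map g1I) <- [_ /mapP[]].
  - by left; exists (map g e') => //; rewrite -!map_comp.
apply: property_pull => //; apply: HK1; split; apply/hypergraphP => e c;
  rewrite /= /hpull_edges /= J'E /=.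
  split=> [[[e0 /(inj_map inlI) -> //]|[e0 ee0 [_]]]|He].
  - by move=> /(map_f g1); rewrite -ee0 => /mapP[].
  - by left; exists e.
split=> // -[[e0 ee0 He]|[e0 ee0 [Je0 _]]].
  case: e0 ee0 He => [_ /hedges_tuple //|x e0].
  by case: e.
have [v vin] := edge_inl Je0.
by have := map_f g1 vin; rewrite -ee0 => /mapP[].
Qed.

(* If G missed a class, a vertex w of this class would be joined to G by
   arbitrary edges without leaving [P]. *)
Lemma strict_meets_class W (H : hypergraph C W) (g : V -> W) (I : Type)
    (f : W -> I) :
  injective g -> hpull g H = G -> unconstrained P H f ->
  forall w, exists v, f (g v) = f w.
Proof.
move=> ginj gH fH w; apply: contrapT => /forallNP nw.
apply: Gstrict.2 => J [J1 J2].
pose phi (x : V + unit) := if x is inl v then g v else w.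
apply: (fH unit _ (fun=> tt) phi) => [|e c mono].
  by move=> [v|[]] [v'|[]] //= [] => [/ginj -> //|vw|vw];
     [case: (nw v); rewrite vw|case: (nw v'); rewrite vw].
(* Every edge at the new vertex also has a vertex of [G], which is of another color, so it is not
   monochromatic. *)
case: (boolP (inr tt \in e)) => ie.
  have nomono v : inl v \in e -> False.
    by move=> ve; apply: (nw v); apply: (mono _ _ ve ie).
  split=> [He|[_ He]]; first by have [v /nomono] := edge_inl He.
  by have [v /nomono] := @edge_inl _ _ (hpull phi H) e c He.
have [e' ->] := seq_inl ie; rewrite (hpullE J1) -map_comp -gH.
by split=> [He|[]//]; split.
Qed.
End Unconstrained.

Section Powers.
Variables (C : Type) (P : hproperty C) (V : finType) (G : hypergraph C V).
Variables (n m : nat) (u : V -> 'I_m).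
Hypothesis Gstrict : strict P G.
Hypothesis decG : dec P G = n.
Hypothesis uG : unconstrained P G u.

(* The vertex (a, v) is the vertex v of the copy G^a of G; the classes of [u]
   are the parts of d_0. *)
Definition respectful_power (S : finType) (Gs : hypergraph C (S * V)%type) :=
  (forall a, hpull (pair a) Gs = G) /\
  (forall e c, hedges Gs (e, c) -> monochromatic (u \o snd) e ->
     monochromatic fst e).

Lemma power_edge (S : finType) (Gs : hypergraph C (S * V)%type) e c :
  respectful_power Gs -> monochromatic fst e ->
  hedges Gs (e, c) <-> hedges G (map snd e, c).
Proof.
move=> [GsG _]; case: e => [|x e] mono.
  by split=> /hedges_tuple.
rewrite {1}(@seq_pair _ _ x.1 (x :: e)) ?(hpullE (GsG _)) // => y ye.
by apply: mono => //; apply: mem_head.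
Qed.

Lemma power_property (S : finType) (Gs : hypergraph C (S * V)%type) :
  respectful_power Gs -> P Gs.
Proof.
move=> GsG; apply: (uG (kappa := fst) (phi := snd)) => [[a v] [b w] //|e c mono].
split=> [He|[mono1 He]]; last exact/(power_edge _ GsG).
have mono1 := GsG.2 _ _ He mono.
by split=> //; apply/(power_edge _ GsG).
Qed.

Lemma power_meets_class (S : finType) (Gs : hypergraph C (S * V)%type)
    (f : S * V -> 'I_n) :
  respectful_power Gs -> (forall i, exists x, f x = i) ->
  unconstrained P Gs f -> forall a i, exists v, f (a, v) = i.
Proof.
move=> GsG fsurj fGs a i; have [x <-] := fsurj i.
by apply: (strict_meets_class Gstrict _ (GsG.1 a) fGs) => v w [].
Qed.

Section InCopy.
Variables (S T : finType) (Gs : hypergraph C (S * V)%type).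
Definition in_copy (t : T) (x : S * V) : (T * S) * V := ((t, x.1), x.2).

Lemma in_copy_inj t : injective (in_copy t).
Proof. by move=> [a v] [b w] [-> ->]. Qed.

(** Crossing classes of [u] makes the new edges harmless for respecting [u]; leaving each copy of
    [Gs] keeps these copies, hence those of [G], induced. *)
Lemma power_extend (E : set (seq ((T * S) * V) * C)) (D : set C) :
  respectful_power Gs -> finite_set D ->
  (forall e, E e -> (2 <= size e.1)%N && uniq e.1 /\ D e.2) ->
  (forall e, E e -> exists x y,
     [/\ x \in e.1, y \in e.1 & u x.2 <> u y.2]) ->
  (forall e t, E e -> exists2 x, x \in e.1 & x.1.1 <> t) ->
  exists Gs' : hypergraph C ((T * S) * V)%type,
    [/\ respectful_power Gs', forall t, hpull (in_copy t) Gs' = Gs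
      & forall e c, hedges Gs' (e, c) <->
          (exists t e0, e = map (in_copy t) e0 /\ hedges Gs (e0, c)) \/
          E (e, c)].
Proof.
move=> GsG finD ED Eu ET.
have [Gs' Gs'E] : exists Gs' : hypergraph C ((T * S) * V)%type, hedges Gs' =
    fun e => (exists t e0, e.1 = map (in_copy t) e0 /\ hedges Gs (e0, e.2)) \/
       E e.
  apply: (@hypergraph_of_edges _ _ _ (colors Gs `|` D)%classic).
    by rewrite finite_setU; split=> //; apply: finite_colors.
  move=> [e c] /= [[t [e0 [-> He0]]]|/ED[tup Dc]]; last by split=> //; right.
  split; last by left; apply: edge_colors He0.
  by apply: edge_map_tuple He0; apply: in_copy_inj.
have inGs t : hpull (in_copy t) Gs' = Gs.
  apply/hypergraphP => e c; rewrite /= /hpull_edges /= Gs'E /=.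
  split=> [[[t' [e0 [ee0 He0]]]|/(ET _ t)[_ /mapP[x _ ->]] //]|He]; last first.
    by left; exists t, e.
  suff -> : e = e0 by [].
  have snde x : ((fun x : T * S * V => (x.1.2, x.2)) \o in_copy x) =1 id.
    by case.
  move/(congr1 (map (fun x => (x.1.2, x.2)))): ee0.
  by rewrite -!map_comp !(eq_map (snde _)) !map_id.
exists Gs'; split=> //; last by move=> e c; rewrite Gs'E.
split=> [[t a]|e c].
  rewrite -(GsG.1 a) -(inGs t); apply/hypergraphP => e c.
  by rewrite /= /hpull_edges /= /hpull_edges /= -map_comp.
rewrite Gs'E => -[[t [e0 [/= -> He0]]]|/Eu[x [y [xe ye uxy]]] mono].
  rewrite !monochromatic_map => mono x y xe ye /=.
  by rewrite (GsG.2 _ _ He0 mono x y).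
by case: uxy; apply: mono.
Qed.
End InCopy.

(* One bad coloring h is eliminated at a time: since the common refinement of h
   and u has more than dec(G) classes, some hypergraph H that agrees with copies
   of G on it is not in P. The edges of H crossing the classes of [u] are put on
   every choice of one copy of G in each of the copies of Gs, so that not all
   of these can be colored by h. *)
Lemma avoid_colorings (L : seq {ffun V -> 'I_n}) :
  (forall h, h \in L -> exists x y, h x = h y /\ u x <> u y) ->
  exists (S : finType) (Gs : hypergraph C (S * V)%type),
    [/\ inhabited S, respectful_power Gs
      & forall f : S * V -> 'I_n, (forall i, exists x, f x = i) ->
          unconstrained P Gs f -> exists a, [ffun v => f (a, v)] \notin L].
Proof.
elim: L => [_|h L IH bad].
  exists unit, (hpull snd G); split=> [||f _ _]; last by exists tt.
    exact: inhabits tt.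
  split=> [a|e c _ _]; last by move=> [[] x] [[] y].
  by apply: hpullK.
have [S [Gs [[a0] GsG GsL]]] :=
  IH (fun g gL => bad g (mem_behead (s := h :: L) gL)).
apply: contrapT => nGs.
have huG : unconstrained P G (fun v => (h v, u v)).
  move=> K W kappa phi H inj HE; apply: contrapT => nPH; apply: nGs.
  (* With one copy of [Gs] per copy number and class of [u], an edge of [H] crossing these classes
     never lies in a single copy; [sigma] selects a copy of [G] in each. *)
  pose T := (K * 'I_m)%type; pose rho w : T := (kappa w, u (phi w)).
  pose psi (sigma : T -> S) w := ((rho w, sigma (rho w)), phi w).
  have psiI sigma : injective (psi sigma).
    by move=> x y [kxy _ _ pxy]; apply: inj; rewrite /= kxy pxy.
  have notmono e : ~ monochromatic (u \o phi) e ->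
      exists x y, [/\ x \in e, y \in e & u (phi x) <> u (phi y)].
    move=> nmono; apply: contrapT => nxy; apply: nmono => x y xe ye.
    by apply: contrapT => uxy; apply: nxy; exists x, y.
  pose E : set (seq ((T * S) * V) * C) := fun e => exists sigma e0,
    [/\ e.1 = map (psi sigma) e0, hedges H (e0, e.2)
       & ~ monochromatic (u \o phi) e0].
  have [|||Gs' [Gs'G inGs' Gs'E]] :=
    @power_extend S T Gs E (colors H) GsG (finite_colors H).
  - move=> [_ c] [sigma [e0 [/= -> He0 _]]].
    by split; [apply: edge_map_tuple He0|apply: edge_colors He0].
  - move=> [_ c] [sigma [e0 [/= -> _ /notmono[x [y [xe ye uxy]]]]]].
    by exists (psi sigma x), (psi sigma y); rewrite !map_f.
  - move=> [_ c] t [sigma [e0 [/= -> _ /notmono[x [y [xe ye uxy]]]]]].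
    have [xt|xt] := pselect (rho x = t); last first.
      by exists (psi sigma x); rewrite ?map_f.
    exists (psi sigma y); rewrite ?map_f //= -xt => -[_ uyx].
    by rewrite uyx in uxy.
  (* A vertex is wanted to inhabit the new index type; with [W] empty, [H] would be in [P]. *)
  have [w0 _] : exists w : W, True.
    apply: contrapT => nW; apply: nPH.
    apply: (uG (kappa := kappa) (phi := phi)) => // e c.
    by case: e => [|w]; [split=> [|[_]] /hedges_tuple|case: nW; exists w].
  exists (T * S)%type, Gs'; split=> // [|f fsurj fGs'].
    exact: inhabits (rho w0, a0).
  apply: contrapT => /forallNP fL.
  (* Each copy of [Gs] contains a copy of [G] whose coloring is outside [L]; as it is in [h :: L],
     it is [h]. *)
  have /fin_all_exists[sigma fsigma] t : exists a, forall v, f ((t, a), v) = h v.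
    have [i||a aL] := GsL (f \o in_copy t).
    - have [v <-] := power_meets_class Gs'G fsurj fGs' (t, a0) i.
      by exists (a0, v).
    - rewrite -(inGs' t); apply: unconstrained_pull => //.
      exact: in_copy_inj.
    exists a => v; have := fL (t, a); rewrite inE negb_or => /negP.
    rewrite negb_and !negbK => /orP[/eqP <-|]; first by rewrite ffunE.
    by rewrite (negPf aL).
  apply: nPH.
  apply: (fGs' unit W (fun=> tt) (psi sigma)) => [|e c mono].
    by move=> x y /(congr1 snd) /psiI.
  have {}mono : monochromatic (h \o phi) e.
    move=> x y xe ye; rewrite /= -(fsigma (rho x)) -(fsigma (rho y)).
    exact: mono.
  have [umono|numono] := pselect (monochromatic (u \o phi) e); last first.
    split=> [He|[_ /Gs'E[[t [e0 [ee0 He0]]]|[sigma' [e0 [ee0 He0 _]]]]]].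
    - by split=> //; apply/Gs'E; right; exists sigma, e.
    (* An edge inside one copy of [Gs] has constant [rho], hence constant [u]. *)
    - have tE x : x \in e -> rho x = t.
        by move=> /(map_f (psi sigma)); rewrite ee0 => /mapP[y _ []].
      by case: numono => x y /tE/(congr1 snd)/= -> /tE/(congr1 snd)/= ->.
    - suff -> : e = e0 by [].
      elim: e e0 ee0 {mono numono He0} => [|x e IHe] [|y e0] //= [].
      move=> kxy _ _ pxy /IHe ->; congr cons.
      by apply: inj; rewrite /= kxy pxy.
  rewrite HE => [|x y xe ye]; last first.
    by congr (_, _); [apply: mono|apply: umono].
  split=> [[kmono Ge]|[_ He]].
    split=> //; apply/(power_edge _ Gs'G); last by rewrite -map_comp.
    rewrite monochromatic_map => x y xe ye /=.
    suff -> : rho x = rho y by [].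
    by congr (_, _); [apply: kmono|apply: umono].
  have fmono : monochromatic fst (map (psi sigma) e).
    apply: (Gs'G.2 _ _ He); rewrite monochromatic_map => x y xe ye.
    exact: umono.
  split; last first.
    by have /(power_edge _ Gs'G fmono) := He; rewrite -map_comp.
  move: fmono; rewrite monochromatic_map => fmono x y xe ye.
  by have [] := fmono x y xe ye.
have := unconstrained_dec huG; rewrite decG => {}huG.
(* If [h] is onto, the projection of the at most [n] classes to the [n] colors is injective, against
   the badness of [h]. Otherwise no copy is colored by [h], and [Gs] itself serves. *)
have [hsurj|/existsNP[i hi]] := pselect (forall i, exists v, h v = i).
  set A := [set _ | v in _] in huG.
  have fstA : fst @: A = [set: 'I_n].
    apply/setP => i; rewrite inE; have [v <-] := hsurj i.
    by apply/imsetP; exists (h v, u v) => //; apply: imset_f; rewrite inE.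
  have /imset_injP fstI : #|fst @: A| == #|A|.
    by rewrite eqn_leq leq_imset_card fstA cardsT card_ord.
  have [x [y [hxy uxy]]] := bad h (mem_head _ _).
  have inA v : (h v, u v) \in A by apply: imset_f; rewrite inE.
  by case: (fstI _ _ (inA x) (inA y) hxy).
apply: nGs; exists S, Gs; split=> // f fsurj fGs.
have [a aL] := GsL f fsurj fGs; exists a; rewrite inE negb_or aL andbT.
have [v fv] := power_meets_class GsG fsurj fGs a i.
by apply/eqP => ah; apply: hi; exists v; rewrite -ah ffunE.
Qed.

Lemma some_good_copy :
  exists (S : finType) (Gs : hypergraph C (S * V)%type),
    [/\ inhabited S, respectful_power Gs
      & forall f : S * V -> 'I_n, (forall i, exists x, f x = i) ->
          unconstrained P Gs f ->
          exists a, forall x y, f (a, x) = f (a, y) -> u x = u y].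
Proof.
pose bad (h : {ffun V -> 'I_n}) :=
  [exists x, exists y, (h x == h y) && (u x != u y)].
have [|S [Gs [S0 GsG GsL]]] := @avoid_colorings (enum bad).
  move=> h; rewrite mem_enum => /existsP[x /existsP[y /andP[/eqP hxy /eqP uxy]]].
  by exists x, y.
exists S, Gs; split=> // f fsurj fGs; have [a aL] := GsL f fsurj fGs.
exists a => x y fxy; apply/eqP; apply: contraNT aL => uxy.
rewrite mem_enum; apply/existsP; exists x; apply/existsP; exists y.
by rewrite !ffunE fxy eqxx.
Qed.

(** Two consecutive elements of a 3-cycle determine which comes first; in a 2-cycle they would
    not. *)
Lemma ordS_cycle (i j : 'I_3) :
  ((i == j) || (ordS i == j)) -> ((i == ordS j) || (ordS i == ordS j)) -> i = j.
Proof.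
by case: i => [[|[|[|]]]] // ?; case: j => [[|[|[|]]]] // ? //=;
   move=> *; apply: val_inj.
Qed.

Lemma ordS_neq (i : 'I_3) : ordS i <> i.
Proof. by case: i => [[|[|[|]]]] // ? /(congr1 val). Qed.

(* Three copies of the previous power in cyclic order: with J in G * K_1 not in
   P, the K_1 is placed at every vertex w of a copy and the G at every copy of G
   in the preceding one, keeping the edges that cross the classes of [u]. If w
   had the color of vertices of a good copy in another class of [u], then all
   the other edges at w would cross the color classes, giving J in P. The
   cyclic order prevents an edge from being prescribed in two ways. *)
Lemma uniform_power :
  exists (S : finType) (Gs : hypergraph C (S * V)%type),
    [/\ inhabited S, respectful_power Gs
      & forall f : S * V -> 'I_n, (forall i, exists x, f x = i) ->
          unconstrained P Gs f -> forall x y, f x = f y -> u x.2 = u y.2].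
Proof.
have [S [Gs [[a0] GsG GsL]]] := some_good_copy.
have /existsNP[J /not_implyP[[J1 J2] nPJ]] := Gstrict.2.
pose theta t a (w : S * V) (x : V + unit) : ('I_3 * S) * V :=
  match x with inl v => ((t, a), v) | inr _ => ((ordS t, w.1), w.2) end.
have thetaI t a w : injective (theta t a w).
  by move=> [v|[]] [v'|[]] // [] => [->|/esym/ordS_neq|/ordS_neq].
pose E : set (seq (('I_3 * S) * V) * C) := fun e => exists t a w e0 x,
  [/\ e.1 = map (theta t a w) e0, hedges J (e0, e.2), inr tt \in e0,
      inl x \in e0 & u x <> u w.2].
have [|||Gs' [Gs'G inGs' Gs'E]] :=
  @power_extend S 'I_3 Gs E (colors J) GsG (finite_colors J).
- move=> [_ c] [t [a [w [e0 [x [/= -> Je0 _ _ _]]]]]].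
  by split; [apply: edge_map_tuple Je0|apply: edge_colors Je0].
- move=> [_ c] [t [a [w [e0 [x [/= -> _ ye xe uxw]]]]]].
  exists (theta t a w (inl x)), (theta t a w (inr tt)).
  by rewrite !(map_f (theta t a w)).
- move=> [_ c] t' [t [a [w [e0 [x [/= -> _ ye xe _]]]]]].
  have [tt'|tt'] := pselect (t = t'); last first.
    by exists (theta t a w (inl x)) => //; apply: map_f.
  exists (theta t a w (inr tt)); first exact: map_f.
  by rewrite /= -tt'; apply: ordS_neq.
exists ('I_3 * S)%type, Gs'; split=> // [|f fsurj fGs'].
  exact: inhabits (ord0, a0).
have /fin_all_exists[a agood] t :
    exists a, forall x y, f ((t, a), x) = f ((t, a), y) -> u x = u y.
  apply: (GsL (f \o in_copy t)) => [i|].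
    have [v <-] := power_meets_class Gs'G fsurj fGs' (t, a0) i.
    by exists (a0, v).
  by rewrite -(inGs' t); apply: unconstrained_pull => //; apply: in_copy_inj.
have next t (w : S * V) x :
    f ((ordS t, w.1), w.2) = f ((t, a t), x) -> u w.2 = u x.
  move=> fwx; apply: contrapT => uwx; apply: nPJ.
  apply: (fGs' unit _ (fun=> tt) (theta t (a t) w)) => [|e c mono].
    by move=> y z /(congr1 snd) /thetaI.
  case: (boolP (inr tt \in e)) => ie; last first.
    have [e' ->] := seq_inl ie; rewrite (hpullE J1) -map_comp.
    rewrite (hpullE (Gs'G.1 (t, a t))).
    by split=> [He|[]//]; split.
  (* The vertices of this edge in the good copy have the color of [w], hence the class of [x], which
     is not that of [w]: the edge was planted. *)
  split=> [Je|[_ He]].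
    have [y ye] := edge_inl Je.
    split=> //; apply/Gs'E; right; exists t, (a t), w, e, y; split=> //.
    suff -> : u y = u x by apply: nesym.
    by apply: (agood t); rewrite -fwx; apply: (mono _ _ ye ie).
  have [y ye] := @edge_inl _ _ (hpull (theta t (a t) w) Gs') e c He.
  (* Conversely, the edge meets two copies of [Gs], so it was planted; these copies determine [t],
     and then the edge of [J]. *)
  move/Gs'E: He => [[t' [e0 [ee0 _]]]|].
    have tagE z : z \in e -> (theta t (a t) w z).1.1 = t'.
      by move=> /(map_f (theta t (a t) w)); rewrite ee0 => /mapP[z' _ ->].
    by have := tagE _ ye; rewrite /= -(tagE _ ie) => /esym/ordS_neq.
  case=> t' [a' [w' [e0 [x0 [/= ee0 Je0 _ _ _]]]]].
  have tagE z : z \in e ->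
      (t' == (theta t (a t) w z).1.1) || (ordS t' == (theta t (a t) w z).1.1).
    move=> /(map_f (theta t (a t) w)); rewrite ee0 => /mapP[[v|[]] _ ->] /=.
      by rewrite eqxx.
    by rewrite eqxx orbT.
  have tt' := ordS_cycle (tagE _ ye) (tagE _ ie); rewrite {}tt' in ee0.
  suff -> : e = e0 by [].
  elim: e e0 ee0 {mono ie ye Je0 tagE} => [|z e IHe] [|z' e0] //= [zz' /IHe ->].
  congr cons; move: z z' zz' => [v|[]] [v'|[]] // [] => [_ ->//||].
    by move=> /esym/ordS_neq.
  by move=> /ordS_neq.
have good t i : exists v, f ((t, a t), v) = i.
  exact: power_meets_class Gs'G fsurj fGs' _ _.
(* Each good copy meets every color, so it passes the comparison on along the cycle. *)
have base k b x z :
    f ((iter k.+1 (@ordS 3) ord0, b), x) = f ((ord0, a ord0), z) -> u x = u z.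
  elim: k b x => [|k IHk] b x fx; first exact: (next ord0 (b, x)).
  have [z' fz'] := good (iter k.+1 (@ordS 3) ord0) (f ((ord0, a ord0), z)).
  rewrite -(IHk _ _ fz'); apply: (next (iter k.+1 (@ordS 3) ord0) (b, x)).
  by rewrite fz' -fx.
(* The extra full turn makes the number of steps positive even for [ord0], as [base] requires. *)
have reach (t : 'I_3) : t = iter t.+3 (@ordS 3) ord0.
  by case: t => [[|[|[|]]]] // ?; apply: val_inj.
move=> [[t b] x] [[t' b'] y] /=; rewrite (reach t) (reach t') => fxy.
have [z fz] := good ord0 (f ((iter t.+3 (@ordS 3) ord0, b), x)).
by rewrite (base _ _ _ _ (esym fz)) (base _ _ _ _ (etrans (esym fxy) (esym fz))).
Qed.
End Powers.

Theorem theorem1 (C : Type) (P : hproperty C) (V : finType)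
    (G : hypergraph C V) (n m : nat) (U : 'I_m -> {set V}) :
  is_property P -> additive P -> induced_hereditary P ->
  strict P G -> dec P G = n -> decomposition P G U ->
  exists (s : nat) (Gs : hypergraph C {_ : 'I_s & V}),
    [/\ (0 < s)%N, hpow G Gs, strict P Gs, respects G U Gs
      & forall d : 'I_n -> {set {_ : 'I_s & V}},
          decomposition P Gs d -> respects_uniformly U d].
Proof.
move=> _ _ hered Gstrict decG decU.
have [u [uU _ uG]] := decomposition_unconstrained hered decU.
have [S [Gs [[a0] GsG Gsu]]] := uniform_power Gstrict decG uG.
pose rho (x : {_ : 'I_#|S| & V}) := (enum_val (tag x) : S, tagged x).
pose rho' (x : S * V) := Tagged (fun=> V) (i := enum_rank x.1) x.2.
have rhoK : cancel rho' rho by move=> [a v]; rewrite /rho /= enum_rankK.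
have rho'K : cancel rho rho' by move=> [i v]; rewrite /rho' /= enum_valK.
have S0 : (0 < #|S|)%N by apply/card_gt0P; exists a0.
have pow : hpow G (hpull rho Gs).
  move=> i; rewrite -(GsG.1 (enum_val i)); apply/hypergraphP => e c.
  by rewrite /= /hpull_edges /= /hpull_edges /= -map_comp.
have PGs : P _ (hpull rho Gs).
  by apply: property_pull (can_inj rho'K) (power_property uG GsG).
exists #|S|, (hpull rho Gs); split=> //.
(* Strictness is inherited from the first copy of [G]. *)
- apply: (strict_super hered Gstrict _ (pow (Ordinal S0)) PGs).
  exact: eq_from_Tagged.
- apply/(respectsP decU.1 pow) => e c He [x [y [xe ye xy]]].
  apply: contrapT => nuxy; move/eqP: xy; apply.
  apply: enum_val_inj.
  apply: (GsG.2 _ _ He _ (rho x) (rho y)); rewrite ?map_f //.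
  rewrite monochromatic_map => {}x {}y {}xe {}ye /=.
  apply: contrapT => uxy; apply: nuxy.
  exists x, y, (u (tagged x)), (u (tagged y)).
  by split=> //; [apply/eqP|apply/uU..].
- move=> d /(decomposition_unconstrained hered)[f [fd fsurj fGs]] i.
  have [v0 fv0] := fsurj i.
  (* Any one vertex of color [i] decides the part, since equal colors force equal classes of [u]. *)
  exists (u (tagged v0)) => k v /fd fv; apply/uU.
  have := Gsu (f \o rho') _ _ (rho (Tagged (fun=> V) (i := k) v)) (rho v0).
  apply=> [j||]; last by rewrite /= !rho'K fv fv0.
    by have [x fx] := fsurj j; exists (rho x); rewrite /= rho'K.
  rewrite -(hpullK Gs rhoK); apply: unconstrained_pull fGs.
  exact: can_inj rhoK.
Qed.
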